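(* Let $q>0$, $\mu=\sqrt q$, $H$ a $d$-dimensional Hilbert space with orthonormal basis $(\psi_r)$, $2\le n\le d$ and $1\le i_1<\dots<i_n\le d$. Set $\overline H_{i_1,\dots,i_n}:=\varepsilon(E_{n-1})H_{i_1,\dots,i_n}^{\otimes(n-1)}$, $R_{i_1,\dots,i_n}:=\frac{1}{\mu^{(n-1)/2}\sqrt{(n-1)!_q}}S_{i_1,\dots,i_n}$ and $\overline R_{i_1,\dots,i_n}:=(-1)^{n-1}R_{i_1,\dots,i_n}$. Then $R_{i_1,\dots,i_n}\in\overline H_{i_1,\dots,i_n}\otimes H_{i_1,\dots,i_n}$, $\overline R_{i_1,\dots,i_n}\in H_{i_1,\dots,i_n}\otimes\overline H_{i_1,\dots,i_n}$, and the conjugate equations hold: $(\overline R_{i_1,\dots,i_n}^*\otimes1_{H_{i_1,\dots,i_n}})(1_{H_{i_1,\dots,i_n}}\otimes R_{i_1,\dots,i_n})=1_{H_{i_1,\dots,i_n}}$, $(R_{i_1,\dots,i_n}^*\otimes1_{\overline H_{i_1,\dots,i_n}})(1_{\overline H_{i_1,\dots,i_n}}\otimes\overline R_{i_1,\dots,i_n})=1_{\overline H_{i_1,\dots,i_n}}$. Hence $\overline H_{i_1,\dots,i_n}$ is a conjugate of $H_{i_1,\dots,i_n}$ in the smallest tensor $*$-category of Hilbert spaces (with subobjects) containing $S_{i_1,\dots,i_n}$.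
   Context: $g_q$ on $H\otimes H$: $g_q\psi_i\otimes\psi_j=-\mu\psi_j\otimes\psi_i$ ($i<j$), $g_q\psi_i\otimes\psi_i=-\psi_i\otimes\psi_i$, $g_q\psi_i\otimes\psi_j=(q-1)\psi_i\otimes\psi_j-\mu\psi_j\otimes\psi_i$ ($i>j$); Jimbo–Woronowicz representation $\varepsilon(g_i)=1_{H^{\otimes(i-1)}}\otimes g_q\otimes1$ of the Hecke algebras $H_m(q)$. $A_1=1$, $A_{m+1}=\sum_{i=0}^mg_i\cdots g_1\sigma(A_m)$, $\sigma(g_i)=g_{i+1}$, $m!_q=\prod_{j=1}^m(1+\dots+q^{j-1})$, $E_m=A_m/m!_q$. $S_{i_1,\dots,i_n}:=\sum_{p\in\mathbb P_n}(-\mu)^{i(p)}\psi_{i_{p(1)}}\otimes\dots\otimes\psi_{i_{p(n)}}$ with $i(p)$ the number of inversions of $p$, viewed as a map $\mathbb C\to H^{\otimes n}$. $H_{i_1,\dots,i_n}=\mathrm{span}\{\psi_{i_1},\dots,\psi_{i_n}\}$. Objects $\sigma,\bar\sigma$ are conjugate if there are $R\in(\iota,\bar\sigma\otimes\sigma)$, $\bar R\in(\iota,\sigma\otimes\bar\sigma)$ satisfying the two conjugate equations above. *)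

(* Defs.v *)
(* Scalars: an arbitrary numeric algebraically closed field C
   (e.g. the complex numbers); H = C^d with orthonormal basis psi_0..psi_{d-1}
   (the paper's psi_1..psi_d, shifted by one).
   A tensor of order m in H^{(x) m} is given by its coordinates in the basis
   psi_{t_1} (x) ... (x) psi_{t_m}, i.e. by a function  seq 'I_d -> C  of which
   only the values on sequences of length m matter. *)
From mathcomp Require Import all_boot all_order all_algebra all_fingroup.
Set Implicit Arguments. Unset Strict Implicit. Unset Printing Implicit Defensive.
Import Order.TTheory GRing.Theory Num.Theory.
Local Open Scope ring_scope.

Section Defs.
Variables (C : numClosedFieldType) (d : nat).

Definition tens := seq 'I_d -> C.

Definition teq (m : nat) (x y : tens) : Prop := forall t : m.-tuple 'I_d, x t = y t.

Definition at_ (t : seq 'I_d) (j : nat) : nat := nth 0%N (map val t) j.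

(* matrix of g_q on H (x) H (parameters q, mu):
   gcoef a b c e = coefficient of psi_a (x) psi_b in g_q (psi_c (x) psi_e). *)
Definition gcoef (q mu : C) (a b c e : nat) : C :=
  if (c < e)%N then (if (a == e) && (b == c) then - mu else 0)
  else if c == e then (if (a == c) && (b == e) then -1 else 0)
  else ((if (a == c) && (b == e) then q - 1 else 0)
        + (if (a == e) && (b == c) then - mu else 0)).

(* epsilon(g_j) = 1_{H^{(x)(j-1)}} (x) g_q (x) 1 on H^{(x) m}, j >= 1:
   g_q acts on the factors j, j+1 (1-based), i.e. positions j-1, j (0-based). *)
Definition eps_g (q mu : C) (m j : nat) (x : tens) : tens :=
  fun t => \sum_(s : m.-tuple 'I_d)
    (if [forall k : 'I_m, ((val k != j.-1) && (val k != j)) ==>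
                          (at_ t k == at_ s k)]
     then gcoef q mu (at_ t j.-1) (at_ t j) (at_ s j.-1) (at_ s j) * x s
     else 0).

(* a word [:: a1; ...; ak] stands for g_{a1} g_{a2} ... g_{ak} *)
Definition word_op (q mu : C) (m : nat) (w : seq nat) (x : tens) : tens :=
  foldr (fun a y => eps_g q mu m a y) x w.

(* A_{k+1} as a formal sum (list) of words in the generators:
   A_1 = 1, A_{m+1} = sum_{i=0}^m g_i ... g_1 sigma(A_m), sigma(g_i) = g_{i+1}. *)
Fixpoint Awords (k : nat) : seq (seq nat) :=
  match k with
  | 0 => [:: [::]]
  | k'.+1 => flatten [seq [seq rev (iota 1 i) ++ map S w | w <- Awords k']
                     | i <- iota 0 k'.+2]
  end.

Definition qfact (q : C) (m : nat) : C :=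
  \prod_(1 <= j < m.+1) \sum_(k < j) q ^+ k.

Definition epsE (q mu : C) (m : nat) (x : tens) : tens :=
  fun t => (qfact q m)^-1 * \sum_(w <- Awords m.-1) word_op q mu m w x t.

Definition inversions (n : nat) (p : 'S_n) : nat :=
  #|[set x : 'I_n * 'I_n | (x.1 < x.2)%N && (p x.2 < p x.1)%N]|.

Definition Svec (mu : C) (n : nat) (i : 'I_n -> 'I_d) : tens :=
  fun t => \sum_(p : 'S_n)
     (- mu) ^+ inversions p * (t == [seq i (p k) | k <- enum 'I_n])%:R.

Definition in_Hi_pow (n : nat) (i : 'I_n -> 'I_d) (m : nat) (x : tens) : Prop :=
  forall t : m.-tuple 'I_d, x t != 0 -> all (fun a => a \in codom i) t.

Definition in_Hbar (q mu : C) (n : nat) (i : 'I_n -> 'I_d) (x : tens) : Prop :=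
  exists y : tens, in_Hi_pow i n.-1 y /\ teq n.-1 x (epsE q mu n.-1 y).

Definition tprod (a : nat) (x y : tens) : tens :=
  fun s => x (take a s) * y (drop a s).

(* (X^* (x) 1) y, with X of order a: contraction of the first a factors *)
Definition contr (a : nat) (X y : tens) : tens :=
  fun u => \sum_(s : a.-tuple 'I_d) (X s)^* * y (s ++ u).

Definition in_tens (a b : nat) (V W : tens -> Prop) (z : tens) : Prop :=
  exists (k : nat) (xs ys : 'I_k -> tens),
    (forall j, V (xs j)) /\ (forall j, W (ys j)) /\
    teq (a + b) z (fun s => \sum_(j < k) tprod a (xs j) (ys j) s).

End Defs.

(* Main.v *)
From HB Require Import structures.
Require Import Defs.
From mathcomp Require Import all_boot all_order all_algebra all_fingroup.
From mathcomp Require Import ring zify.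
Set Implicit Arguments. Unset Strict Implicit. Unset Printing Implicit Defensive.
Import Order.TTheory GRing.Theory Num.Theory.
Local Open Scope ring_scope.

(* The quadratic, far-commutation and braid relations alone give g_j A_m = q A_m, while
   A_m acts on a common eigenvector of the g_j as the sum of q^(word length), that is
   m!_q.  Hence Hbar consists of the tensors [x] with g_j x = q x for all j and letters
   among the psi_(i_r).  In coordinates this eigenvalue condition says that exchanging
   two adjacent letters a < b multiplies [x] by [- mu] and that [x] vanishes on repeated
   letters; so it is inherited by the slices of S, and [x t] is proportional to
   (- mu)^(inv t) on the rearrangements of a given word.  Both conjugate equations then
   reduce to one contraction,
     sum_s S(a, s) S(s, b) = delta_(a, b) (- mu)^(n-1) (n-1)!_q,
   which follows from inv(a, s) + inv(s, a) = 2 inv s + (n - 1) and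
   sum_s q^(inv s) = (n-1)!_q. *)

Lemma adjacent_swap_perm_ind (T : eqType) (P : seq T -> Prop) :
  (forall u a b v, P (u ++ [:: a, b & v]) -> P (u ++ [:: b, a & v])) ->
  forall s t, perm_eq s t -> P s -> P t.
Proof.
move=> swapP; apply: catCA_perm_ind => s1 s2 s3.
have move_letter u a s v : P (u ++ a :: s ++ v) -> P (u ++ s ++ a :: v).
  by elim: s u => // b s IH u /swapP; rewrite -cat_rcons => /IH; rewrite cat_rcons.
suff swap_blocks u : P (u ++ s1 ++ s2 ++ s3) -> P (u ++ s2 ++ s1 ++ s3).
  exact: (swap_blocks [::]).
elim: s1 u => // a s1 IH u; rewrite /= -cat_rcons => /IH; rewrite cat_rcons.
exact: move_letter.
Qed.

Lemma perm_cons_inj (T : eqType) (a b : T) s : perm_eq (a :: s) (b :: s) -> a = b.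
Proof. by move/seq.permP/(_ (pred1 b)); rewrite /= eqxx => /addIn; case: eqP. Qed.

Lemma not_uniq_perm_eq (T : eqType) (t : seq T) : ~~ uniq t ->
  exists a r, perm_eq t [:: a, a & r].
Proof.
elim: t => //= b t IH; rewrite negb_and negbK => /orP[bt|/IH[a [r tr]]].
  by exists b, (rem b t); rewrite perm_cons perm_to_rem.
exists a, (b :: r); rewrite -(permPr (permEl (perm_catCA [:: b] [:: a; a] r))).
by rewrite perm_cons.
Qed.

Lemma uniq_complete_perm (T : eqType) (L u : seq T) :
  uniq L -> uniq u -> {subset u <= L} -> size L = (size u).+1 ->
  exists b, perm_eq (b :: u) L.
Proof.
move=> uniqL uniq_u uL sizeL.
have /hasP[b bL bu] : has (predC (mem u)) L.
  rewrite has_predC; apply/negP => /allP Lu.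
  by have := uniq_leq_size uniqL Lu; rewrite sizeL ltnn.
have uniq_bu : uniq (b :: u) by rewrite /= uniq_u andbT.
have buL : {subset b :: u <= L} by move=> a; rewrite inE => /predU1P[-> //|/uL].
by exists b; apply: uniq_perm => //; case: (uniq_min_size uniq_bu buL); rewrite ?sizeL.
Qed.

Lemma forall_ord_recl n (P : pred 'I_n.+1) :
  [forall k, P k] = P ord0 && [forall k, P (lift ord0 k)].
Proof.
apply/forallP/andP => [Pk|[P0 /forallP Pl] k]; last by case: (unliftP ord0 k) => [j|] ->.
by split=> //; apply/forallP.
Qed.

Section TupleSums.
Variables (V : nmodType) (T : finType).

Lemma sum_tuple_cons m (F : m.+1.-tuple T -> V) :
  \sum_s F s = \sum_(a : T) \sum_(s : m.-tuple T) F [tuple of a :: s].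
Proof.
rewrite pair_bigA (reindex (fun p : T * m.-tuple T => [tuple of p.1 :: p.2])) //=.
exists (fun s => (thead s, [tuple of behead s])) => [[a s] _|s _].
  by congr (_, _); apply: val_inj.
by rewrite /= -tuple_eta.
Qed.

Lemma sum_tuple_rcons m (F : m.+1.-tuple T -> V) :
  \sum_s F s = \sum_(a : T) \sum_(s : m.-tuple T) F [tuple of rcons s a].
Proof.
pose rv k (s : k.-tuple T) := [tuple of rev s].
have rvK k : involutive (@rv k) by move=> s; apply: val_inj; rewrite /= revK.
rewrite (reindex_inj (inv_inj (@rvK m.+1))) sum_tuple_cons.
apply: eq_bigr => a _; rewrite (reindex_inj (inv_inj (@rvK m))).
by apply: eq_bigr => s _; congr F; apply: val_inj; rewrite /= rev_cons revK.
Qed.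

End TupleSums.

Definition descending_word i : seq nat := rev (iota 1 i).

Lemma big_AwordsS (V : nmodType) (F : seq nat -> V) k :
  \sum_(w <- Awords k.+1) F w =
  \sum_(0 <= i < k.+2) \sum_(w <- Awords k) F (descending_word i ++ map S w).
Proof.
rewrite [LHS]big_flatten big_map.
by apply: eq_bigr => i _; rewrite big_map.
Qed.

Lemma Awords_letters k w : w \in Awords k -> all (fun j => 0 < j <= k)%N w.
Proof.
elim: k w => [|k IH] w; first by rewrite inE => /eqP ->.
case/flatten_mapP=> i; rewrite mem_iota => ik /mapP[w' /IH w'_letters ->].
rewrite all_cat all_rev all_map; apply/andP; split.
  by apply/allP => j; rewrite mem_iota; lia.
by apply: sub_all w'_letters => j /=; lia.
Qed.

Section QuantumFactorial.
Variables (C : numClosedFieldType) (q : C).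

Lemma qfactS m : qfact q m.+1 = qfact q m * \sum_(k < m.+1) q ^+ k.
Proof. by rewrite /qfact big_nat_recr. Qed.

Lemma qfact_gt0 m : 0 < q -> 0 < qfact q m.
Proof.
move=> q_gt0; elim: m => [|m IH]; first by rewrite /qfact big_geq.
rewrite qfactS mulr_gt0 // big_ord_recl ltr_wpDr // sumr_ge0 // => l _.
by rewrite exprn_ge0 // ltW.
Qed.

Lemma sum_q_size_Awords k : \sum_(w <- Awords k) q ^+ size w = qfact q k.+1.
Proof.
elim: k => [|k IH]; first by rewrite big_seq1 /qfact big_nat1 big_ord1 !expr0.
rewrite big_AwordsS qfactS -IH big_mkord mulr_sumr.
apply: eq_bigr => i _; rewrite mulr_suml; apply: eq_bigr => w _.
by rewrite size_cat size_rev size_iota size_map exprD mulrC.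
Qed.

End QuantumFactorial.

Section HeckeModules.
Variables (R : pzRingType) (V : lmodType R).
Implicit Types (q : R) (g : nat -> {linear V -> V}) (v : V) (w : seq nat).

(* The generators of H_m(q) are [g 1], ..., [g (m - 1)]. *)
Definition hecke_relations q m g : Prop :=
  [/\ forall k v, (k.+1 < m)%N ->
        g k.+1 (g k.+1 v) = (q - 1) *: g k.+1 v + q *: v,
      forall k l v, (k.+1 < l)%N -> (l.+1 < m)%N ->
        g k.+1 (g l.+1 v) = g l.+1 (g k.+1 v) &
      forall k v, (k.+2 < m)%N ->
        g k.+1 (g k.+2 (g k.+1 v)) = g k.+2 (g k.+1 (g k.+2 v))].

Definition hecke_eigen q m g v : Prop :=
  forall k, (k.+1 < m)%N -> g k.+1 v = q *: v.

Definition hecke_word g w v : V := foldr (fun j => g j) v w.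

Fact hecke_word_is_linear g w : linear (hecke_word g w).
Proof. by move=> c u v; elim: w => //= j w ->; rewrite linearP. Qed.

HB.instance Definition _ g w :=
  GRing.isLinear.Build R V V *:%R (hecke_word g w) (hecke_word_is_linear g w).

Definition qantisym g k v : V := \sum_(w <- Awords k) hecke_word g w v.

Lemma hecke_word_descendingS g i v :
  hecke_word g (descending_word i.+1) v = g i.+1 (hecke_word g (descending_word i) v).
Proof. by rewrite /descending_word -{1}(addn1 i) iotaD rev_cat. Qed.

Lemma hecke_word_map_succ g w v :
  hecke_word g (map S w) v = hecke_word (fun j => g j.+1) w v.
Proof. exact: foldr_map. Qed.

Lemma qantisymS g k v : qantisym g k.+1 v =
  \sum_(0 <= i < k.+2)
    hecke_word g (descending_word i) (qantisym (fun j => g j.+1) k v).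
Proof.
rewrite /qantisym big_AwordsS; apply: eq_bigr => i _; rewrite linear_sum.
by apply: eq_bigr => w _; rewrite -hecke_word_map_succ; exact: foldr_cat.
Qed.

Lemma hecke_relations_shift q m g :
  hecke_relations q m.+1 g -> hecke_relations q m (fun j => g j.+1).
Proof.
case=> quadratic far braid.
by split=> [k v km|k l v kl lm|k v km]; [apply: quadratic|apply: far|apply: braid].
Qed.

Section Relations.
Variables (q : R) (m : nat) (g : nat -> {linear V -> V}).
Hypothesis g_rel : hecke_relations q m g.

Lemma hecke_descending_above i j v : (i < j)%N -> (j.+1 < m)%N ->
  g j.+1 (hecke_word g (descending_word i) v)
  = hecke_word g (descending_word i) (g j.+1 v).
Proof.
have [_ far _] := g_rel.
elim: i => [|i IH] ij jm //; rewrite !hecke_word_descendingS -far //.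
by rewrite IH // ltnW.
Qed.

Lemma hecke_descending_below i j v : (j.+1 < i)%N -> (i < m)%N ->
  g j.+1 (hecke_word g (descending_word i) v)
  = hecke_word g (descending_word i) (g j.+2 v).
Proof.
have [_ far braid] := g_rel.
elim: i => // i IH; rewrite ltnS leq_eqVlt => /predU1P[<-|ji] im.
  by rewrite !hecke_word_descendingS braid // hecke_descending_above.
by rewrite !hecke_word_descendingS far // IH // ltnW.
Qed.

(* By the quadratic relation g_j acts as [q] on the terms [i = j - 1] and [i = j] taken
   together; it slides through every other g_i ... g_1, becoming g_j or g_(j+1). *)
Lemma sum_descending_eigen v : (forall k, (k.+2 < m)%N -> g k.+2 v = q *: v) ->
  hecke_eigen q m g (\sum_(0 <= i < m) hecke_word g (descending_word i) v).
Proof.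
move=> v_eigen j jm; have [quadratic _ _] := g_rel.
have slide i : (i < j)%N || (j.+1 < i)%N -> (i < m)%N ->
    g j.+1 (hecke_word g (descending_word i) v)
    = q *: hecke_word g (descending_word i) v.
  case/orP=> ij im; rewrite -linearZ /=.
    by case: j jm ij => // j jm ij; rewrite hecke_descending_above // v_eigen.
  by rewrite hecke_descending_below // v_eigen // (leq_ltn_trans ij).
rewrite linear_sum scaler_sumr !(big_cat_nat (n := j) (leq0n j) (ltnW (ltnW jm))) /=.
congr (_ + _).
  by apply: eq_big_nat => i /andP[_ ij]; rewrite slide ?ij // (ltn_trans ij) // ltnW.
rewrite !(big_ltn (ltnW jm)) !(big_ltn jm) !addrA; congr (_ + _).
  rewrite hecke_word_descendingS quadratic // scalerBl scale1r addrA addrC.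
  by rewrite [X in _ + X]addrC subrK.
by apply: eq_big_nat => i /andP[ij im]; rewrite slide // ij orbT.
Qed.

End Relations.

Lemma qantisym_eigen q k g v : hecke_relations q k.+1 g ->
  hecke_eigen q k.+1 g (qantisym g k v).
Proof.
elim: k g => [|k IH] g g_rel j //; rewrite qantisymS => jk.
apply: (sum_descending_eigen g_rel) => // l lk.
exact: (IH _ (hecke_relations_shift g_rel)).
Qed.

Lemma hecke_word_eigen q m g w v : hecke_eigen q m g v ->
  all (fun j => 0 < j < m)%N w -> hecke_word g w v = q ^+ size w *: v.
Proof.
move=> v_eigen; elim: w => [|[|j] w IH] //=; first by rewrite scale1r.
by case/andP=> jm /IH ->; rewrite linearZ /= v_eigen // scalerA -exprSr.
Qed.

End HeckeModules.

Lemma qantisym_of_eigen (C : numClosedFieldType) (V : lmodType C) (q : C) k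
    (g : nat -> {linear V -> V}) (v : V) :
  hecke_eigen q k.+1 g v -> qantisym g k v = qfact q k.+1 *: v.
Proof.
move=> v_eigen; rewrite -sum_q_size_Awords scaler_suml.
by apply: eq_big_seq => w /Awords_letters; exact: (hecke_word_eigen v_eigen).
Qed.

Section AdjacentGenerators.
Variables (disp : Order.disp_t) (T : orderType disp) (R : comPzRingType) (mu : R).
Implicit Types (x y : seq T -> R) (t u v : seq T).

(* Coordinates of g_q, with [q = mu ^ 2], acting on the factors [k] and [k + 1] (counted
   from 0) of the tensor with coordinates [x]; 0 when [t] is too short. *)
Fixpoint gq_at k x t : R :=
  match k, t with
  | 0, [:: a, b & u] =>
      (if a == b then -1 else - mu) * x [:: b, a & u]
      + (if (b < a)%O then mu ^+ 2 - 1 else 0) * x t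
  | k'.+1, a :: u => gq_at k' (fun s => x (a :: s)) u
  | _, _ => 0
  end.

Definition gq_word (w : seq nat) x := foldr (fun j => gq_at j.-1) x w.

Lemma gq_at_cat x u a b v :
  gq_at (size u) x (u ++ [:: a, b & v])
  = gq_at 0 (fun s => x (u ++ s)) [:: a, b & v].
Proof. by elim: u x => // c u IH x; exact: IH. Qed.

Lemma gq_at_local k x y t : (forall s, perm_eq s t -> x s = y s) ->
  gq_at k x t = gq_at k y t.
Proof.
elim: k x y t => [|k IH] x y [|a t] //= xy; last first.
  by apply: IH => s st; apply: xy; rewrite perm_cons.
case: t xy => // b t xy; rewrite !xy //.
by apply/permPl; exact: (perm_catCA [:: b] [:: a]).
Qed.

Lemma gq_at0 k t : gq_at k (fun=> 0) t = 0.
Proof. by elim: k t => [|k IH] [|a [|b t]] //=; rewrite ?IH // !mulr0 addr0. Qed.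

Lemma gq_at_lin k c e x y t :
  gq_at k (fun s => c * x s + e * y s) t = c * gq_at k x t + e * gq_at k y t.
Proof.
elim: k x y t => [|k IH] x y [|a t] /=; rewrite ?mulr0 ?addr0 //.
by case: t => [|b t]; [rewrite !mulr0 addr0|ring].
Qed.

Lemma gq_at_quadratic k x t : (k.+1 < size t)%N ->
  gq_at k (gq_at k x) t = (mu ^+ 2 - 1) * gq_at k x t + mu ^+ 2 * x t.
Proof.
elim: k x t => [|k IH] x [|a t] //=; last exact: IH.
by case: t => // b t _; case: (ltgtP a b) => [ab|ab|->] /=; ring.
Qed.

Lemma gq_at_far k l x t : (k.+1 < l)%N -> (l.+1 < size t)%N ->
  gq_at k (gq_at l x) t = gq_at l (gq_at k x) t.
Proof.
elim: k l x t => [|k IH] [|l] x [|a t] //= kl lt; last exact: IH.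
case: l kl lt => // l _; case: t => // b t lt.
by rewrite /= gq_at_lin.
Qed.

Lemma gq_at_braid k x t : (k.+2 < size t)%N ->
  gq_at k (gq_at k.+1 (gq_at k x)) t = gq_at k.+1 (gq_at k (gq_at k.+1 x)) t.
Proof.
elim: k x t => [|k IH] x [|a t] //= lt; last exact: IH.
case: t lt => [|b [|c t]] // _ /=.
case: (ltgtP b c) => [bc|cb|<-]; last by case: (ltgtP a b) => _ /=; ring.
  case: (ltgtP a b) => [ab|ba|->]; last by rewrite (lt_eqF bc) (lt_gtF bc); ring.
    by have ac := lt_trans ab bc; rewrite (lt_eqF ac) (lt_gtF ac); ring.
  by case: (ltgtP a c) => _; ring.
case: (ltgtP a b) => [ab|ba|->]; last by rewrite (gt_eqF cb) cb; ring.
  by case: (ltgtP a c) => _; ring.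
by have ca := lt_trans cb ba; rewrite (gt_eqF ca) ca; ring.
Qed.

Lemma gq_word_local w x y t : (forall s, perm_eq s t -> x s = y s) ->
  gq_word w x t = gq_word w y t.
Proof.
elim: w t => [|j w IH] t xy; first exact: xy.
by apply: gq_at_local => s st; apply: IH => r rs; exact: xy (perm_trans rs st).
Qed.

Lemma gq_word0 w t : gq_word w (fun=> 0) t = 0.
Proof.
elim: w t => // j w IH t; rewrite -[RHS](gq_at0 j.-1 t).
by apply: gq_at_local => s _; exact: IH.
Qed.

End AdjacentGenerators.

Section TensorModule.
Variables (disp : Order.disp_t) (T : finOrderType disp) (R : comPzRingType) (mu : R).
Variable m : nat.
Implicit Types (X : {ffun m.-tuple T -> R^o}) (x : seq T -> R).

Definition zero_ext X : seq T -> R := fun s => oapp X 0 (insub s).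

Definition tuple_restr x : {ffun m.-tuple T -> R^o} := [ffun t : m.-tuple T => x t].

Lemma zero_ext_tuple X (t : m.-tuple T) : zero_ext X t = X t.
Proof. by rewrite /zero_ext valK. Qed.

Lemma tuple_restrK x s : size s = m -> zero_ext (tuple_restr x) s = x s.
Proof.
by move/eqP=> size_s; rewrite -[s]/(tval (Tuple size_s)) zero_ext_tuple ffunE.
Qed.

Definition tens_gq j X : {ffun m.-tuple T -> R^o} :=
  tuple_restr (gq_at mu j.-1 (zero_ext X)).

Fact tens_gq_is_linear j : linear (tens_gq j).
Proof.
move=> c X Y; apply/ffunP => t; rewrite !ffunE.
rewrite -[in RHS](mul1r (gq_at _ _ (zero_ext Y) _)) -gq_at_lin.
apply: gq_at_local => s _; rewrite /zero_ext; case: insub => [u|] /=.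
  by rewrite !ffunE mul1r.
by rewrite !mulr0 addr0.
Qed.

HB.instance Definition _ j :=
  GRing.isLinear.Build R {ffun m.-tuple T -> R^o} {ffun m.-tuple T -> R^o} *:%R
    (tens_gq j) (tens_gq_is_linear j).

Lemma hecke_word_tens_gq w X (t : m.-tuple T) :
  hecke_word tens_gq w X t = gq_word mu w (zero_ext X) t.
Proof.
elim: w t => [|j w IH] t; first by rewrite /= zero_ext_tuple.
rewrite [LHS]ffunE; apply: gq_at_local => s /perm_size; rewrite size_tuple => /eqP size_s.
by rewrite -[s]/(tval (Tuple size_s)) zero_ext_tuple; exact: IH.
Qed.

Lemma tens_gq_relations : hecke_relations (mu ^+ 2) m tens_gq.
Proof.
split=> [k X km|k l X kl lm|k X km]; apply/ffunP => t.
- have /= -> := hecke_word_tens_gq [:: k.+1; k.+1] X t.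
  by rewrite gq_at_quadratic ?size_tuple // zero_ext_tuple !ffunE.
- have /= -> := hecke_word_tens_gq [:: k.+1; l.+1] X t.
  have /= -> := hecke_word_tens_gq [:: l.+1; k.+1] X t.
  by rewrite gq_at_far ?size_tuple.
- have /= -> := hecke_word_tens_gq [:: k.+1; k.+2; k.+1] X t.
  have /= -> := hecke_word_tens_gq [:: k.+2; k.+1; k.+2] X t.
  by rewrite gq_at_braid ?size_tuple.
Qed.

Lemma tens_gq_tuple_restr k x (t : m.-tuple T) :
  tens_gq k.+1 (tuple_restr x) t = gq_at mu k x t.
Proof.
rewrite ffunE; apply: gq_at_local => s /perm_size.
by rewrite size_tuple => /tuple_restrK.
Qed.

End TensorModule.
Arguments tens_gq {disp T R} mu m j X.

Section EpsilonGenerators.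
Variables (C : numClosedFieldType) (d : nat) (mu : C).
Implicit Types (x : tens C d).

Lemma gcoefE (a b c e : 'I_d) : gcoef (mu ^+ 2) mu a b c e =
  (if (c, e) == (b, a) then if a == b then -1 else - mu else 0)
  + (if (c, e) == (a, b) then if (b < a)%O then mu ^+ 2 - 1 else 0 else 0).
Proof.
rewrite /gcoef !xpair_eqE -!(inj_eq (@ord_inj d)) ltEord.
rewrite !(eq_sym (a : nat)) !(eq_sym (b : nat)).
case: (ltngtP c e) => ce; case: (ltngtP b a) => ba;
  case: (eqVneq (e : nat) a) => ea; case: (eqVneq (c : nat) b) => cb;
  case: (eqVneq (c : nat) a) => ca; case: (eqVneq (e : nat) b) => eb;
  rewrite /= ?addr0 ?add0r //; exfalso; lia.
Qed.

Lemma sum_gcoef (F : 'I_d -> 'I_d -> C) (a b : 'I_d) :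
  \sum_(c : 'I_d) \sum_(e : 'I_d) gcoef (mu ^+ 2) mu a b c e * F c e =
  (if a == b then -1 else - mu) * F b a
  + (if (b < a)%O then mu ^+ 2 - 1 else 0) * F a b.
Proof.
rewrite pair_bigA (eq_bigr (fun p =>
    (if p == (b, a) then (if a == b then -1 else - mu) * F p.1 p.2 else 0)
  + (if p == (a, b) then (if (b < a)%O then mu ^+ 2 - 1 else 0) * F p.1 p.2 else 0)))
  => [|[c e] _].
  by rewrite big_split -!big_mkcond !big_pred1_eq.
by rewrite gcoefE mulrDl; congr (_ + _); case: ifP => _; rewrite ?mul0r.
Qed.

Lemma forall_at_eq_off01 m (a b c e : 'I_d) (t s : m.-tuple 'I_d) :
  [forall k : 'I_m.+2, ((val k != 0%N) && (val k != 1%N)) ==>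
     (at_ [:: a, b & t] k == at_ [:: c, e & s] k)] = (s == t).
Proof.
rewrite !forall_ord_recl /=; apply/forallP/eqP => [ts|-> k]; last exact: eqxx.
apply/val_inj/(inj_map (@ord_inj d)); apply: (eq_from_nth (x0 := 0%N)).
  by rewrite !size_map !size_tuple.
move=> k; rewrite size_map size_tuple => km; apply/esym/eqP.
exact: (ts (Ordinal km)).
Qed.

Lemma eps_g1 m x (a b : 'I_d) (t : m.-tuple 'I_d) :
  eps_g (mu ^+ 2) mu m.+2 1 x [:: a, b & t] = gq_at mu 0 x [:: a, b & t].
Proof.
rewrite /= -(sum_gcoef (fun c e => x [:: c, e & t])) /eps_g sum_tuple_cons.
apply: eq_bigr => c _; rewrite sum_tuple_cons; apply: eq_bigr => e _.
under eq_bigr => s _ do rewrite /= forall_at_eq_off01.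
by rewrite -big_mkcond big_pred1_eq.
Qed.

Lemma eps_gS m k x (a : 'I_d) (t : m.-tuple 'I_d) :
  eps_g (mu ^+ 2) mu m.+1 k.+2 x (a :: t)
  = eps_g (mu ^+ 2) mu m k.+1 (fun s => x (a :: s)) t.
Proof.
rewrite /eps_g sum_tuple_cons (bigD1 a) //= [X in _ + X]big1 ?addr0 => [|c ca].
  by apply: eq_bigr => s _; rewrite forall_ord_recl /= eqxx.
apply: big1 => s _; rewrite forall_ord_recl; case: ifP => // /andP[/eqP/ord_inj ac].
by rewrite ac eqxx in ca.
Qed.

Lemma eps_g_gq_at m k x (t : m.-tuple 'I_d) : (k.+1 < m)%N ->
  eps_g (mu ^+ 2) mu m k.+1 x t = gq_at mu k x t.
Proof.
elim: k m x t => [|k IH] [|m] x t //; case/tupleP: t => a t km.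
  by case: m t km => // m t _; case/tupleP: t => b t; exact: eps_g1.
by rewrite eps_gS IH.
Qed.

Lemma word_op_gq_word m w x (t : m.-tuple 'I_d) : all (fun j => 0 < j < m)%N w ->
  word_op (mu ^+ 2) mu m w x t = gq_word mu w x t.
Proof.
elim: w t => [|[|j] w IH] t //= /andP[jm w_letters]; rewrite eps_g_gq_at //.
apply: gq_at_local => s /perm_size; rewrite size_tuple => /eqP size_s.
by rewrite -[s]/(tval (Tuple size_s)) IH.
Qed.

Lemma epsE_gq_word k x (t : k.+1.-tuple 'I_d) :
  epsE (mu ^+ 2) mu k.+1 x t =
  (qfact (mu ^+ 2) k.+1)^-1 * \sum_(w <- Awords k) gq_word mu w x t.
Proof.
congr (_ * _); apply: eq_big_seq => w /Awords_letters w_letters.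
exact: word_op_gq_word.
Qed.

Lemma epsE_qantisym k x (t : k.+1.-tuple 'I_d) :
  epsE (mu ^+ 2) mu k.+1 x t =
  ((qfact (mu ^+ 2) k.+1)^-1 *: qantisym (tens_gq mu k.+1) k (tuple_restr k.+1 x)) t.
Proof.
rewrite epsE_gq_word ffunE sum_ffunE; congr (_ * _); apply: eq_bigr => w _.
rewrite hecke_word_tens_gq; apply: gq_word_local => s /perm_size.
by rewrite size_tuple => /tuple_restrK.
Qed.

End EpsilonGenerators.

Section Inversions.
Variables (disp : Order.disp_t) (T : orderType disp).
Implicit Types s t u v : seq T.

Fixpoint inv_count t : nat :=
  if t is a :: u then (count (< a)%O u + inv_count u)%N else 0%N.

Lemma inv_count_swap u a b v : (a < b)%O ->
  inv_count (u ++ [:: b, a & v]) = (inv_count (u ++ [:: a, b & v])).+1.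
Proof.
move=> ab; elim: u => [|c u IH] /=; first by rewrite ab lt_gtF //; lia.
by rewrite IH !count_cat /=; lia.
Qed.

Lemma inv_count_rcons t b :
  inv_count (rcons t b) = (inv_count t + count (> b)%O t)%N.
Proof. by elim: t => //= a t IH; rewrite IH -cats1 count_cat /= addn0 addnACA. Qed.

Lemma inv_count_cons_rcons t b : b \notin t ->
  (inv_count (b :: t) + inv_count (rcons t b) = 2 * inv_count t + size t)%N.
Proof.
move=> bt; have <- : (count (< b)%O t + count (> b)%O t = size t)%N.
  rewrite -(count_predC (< b)%O t); congr (_ + _)%N; apply: eq_in_count => a a_in.
  by rewrite /= -leNgt le_eqVlt; case: eqP a_in bt => // -> ->.
by rewrite inv_count_rcons /=; lia.
Qed.

Lemma inv_count_map_enum m (f : 'I_m -> T) :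
  inv_count [seq f k | k <- enum 'I_m] =
  #|[set x : 'I_m * 'I_m | (x.1 < x.2)%N && (f x.2 < f x.1)%O]|.
Proof.
transitivity (\sum_(a < m) \sum_(b < m) ((a < b)%N && (f b < f a)%O))%N; last first.
  rewrite pair_bigA -sum1dep_card [RHS]big_mkcond.
  by apply: eq_bigr => -[a b] _ /=; case: ifP.
elim: m f => [|m IH] f; first by rewrite big_ord0 enum_ord0.
rewrite enum_ordSl /= -map_comp (IH (f \o lift ord0)) big_ord_recl; congr (_ + _)%N.
  rewrite big_ord_recl /= add0n count_map -sum1_count big_enum_cond.
  by rewrite big_mkcond; apply: eq_bigr => b _ /=; case: ifP.
by apply: eq_bigr => a _; rewrite big_ord_recl.
Qed.

Lemma sum_q_rank (R : pzSemiRingType) (q : R) (L : seq T) : uniq L ->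
  \sum_(a <- L) q ^+ count (< a)%O L = \sum_(k < size L) q ^+ k.
Proof.
move=> uniqL; pose S := sort <=%O L.
have SL : perm_eq S L by rewrite perm_sort.
under eq_bigr => a _ do rewrite -(seq.permP SL).
rewrite -(perm_big _ SL) -(perm_size SL).
case SE : S => [|a0 S']; first by rewrite big_nil big_ord0.
rewrite -SE (big_nth a0) big_mkord; apply: eq_bigr => k _.
by rewrite count_lt_nth // sort_lt_sorted.
Qed.

End Inversions.

Lemma sum_q_inv_count disp (T : finOrderType disp) (C : numClosedFieldType) (q : C) m
    (L : seq T) : uniq L -> size L = m ->
  \sum_(s : m.-tuple T | perm_eq s L) q ^+ inv_count s = qfact q m.
Proof.
elim: m L => [|m IH] L uniqL sizeL.
  rewrite (size0nil sizeL) /qfact big_geq // (big_pred1 [tuple]) // => s.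
  by rewrite tuple0 /= eqxx.
have rankE := sum_q_rank q uniqL; rewrite sizeL in rankE.
rewrite big_mkcond sum_tuple_cons qfactS -rankE mulr_sumr.
rewrite [RHS]big_uniq //= [RHS]big_mkcond.
apply: eq_bigr => a _; have [aL|aL] := boolP (a \in L); last first.
  by apply: big1 => s _; case: ifP => // /perm_mem/(_ a); rewrite mem_head (negPf aL).
have remL := perm_to_rem aL.
rewrite -(IH (rem a L)) ?rem_uniq ?size_rem ?sizeL // mulr_suml [RHS]big_mkcond.
apply: eq_bigr => s _; rewrite (permPr remL) perm_cons; case: ifP => // sL.
rewrite mulrC -exprD /=; congr (_ ^+ (_ + _)).
by rewrite (seq.permP remL) /= ltxx (seq.permP sL).
Qed.

Section QuantumAlternating.
Variables (disp : Order.disp_t) (T : orderType disp) (R : comPzRingType) (mu : R).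
Implicit Types (x : seq T -> R) (s t u v L : seq T).

Definition qalternating m x : Prop :=
  (forall u a b v, size (u ++ [:: a, b & v]) = m -> (a < b)%O ->
     x (u ++ [:: b, a & v]) = - mu * x (u ++ [:: a, b & v])) /\
  (forall u a v, size (u ++ [:: a, a & v]) = m -> x (u ++ [:: a, a & v]) = 0).

Lemma qalternating_cons m x c :
  qalternating m.+1 x -> qalternating m (fun s => x (c :: s)).
Proof.
case=> swap repeat; split=> [u a b v size_u|u a v size_u].
  by apply: (swap (c :: u)); rewrite /= size_u.
by apply: (repeat (c :: u)); rewrite /= size_u.
Qed.

Lemma qalternating_rcons m x c :
  qalternating m.+1 x -> qalternating m (fun s => x (rcons s c)).
Proof.
case=> swap repeat; split=> [u a b v size_u|u a v size_u]; rewrite !rcons_cat /=.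
  by apply: swap; rewrite -size_u -!rcons_cons -rcons_cat size_rcons.
by apply: repeat; rewrite -size_u -!rcons_cons -rcons_cat size_rcons.
Qed.

Lemma qalternatingZ m c x : qalternating m x -> qalternating m (fun s => c * x s).
Proof.
case=> swap repeat; split=> [u a b v size_u ab|u a v size_u].
  by rewrite (swap _ _ _ _ size_u ab) mulrCA.
by rewrite repeat // mulr0.
Qed.

Lemma gq_at_qalternating m k x t : qalternating m x -> size t = m -> (k.+1 < m)%N ->
  gq_at mu k x t = mu ^+ 2 * x t.
Proof.
case=> swap repeat size_t km.
have [u [a [b [v [<- tE]]]]] : exists u a b v, size u = k /\ t = u ++ [:: a, b & v].
  rewrite -{}size_t in km; elim: k t km {swap repeat} => [|k IH] [|a [|b t]] // km.
    by exists [::], a, b, t.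
  by have [u [c [e [v [<- ->]]]]] := IH (b :: t) km; exists (a :: u), c, e, v.
rewrite tE in size_t *; rewrite gq_at_cat /=.
case: (ltgtP a b) size_t => [ab|ba|->] size_t.
- by rewrite swap //; ring.
- by rewrite [x (u ++ [:: a, b & v])]swap //; first ring; rewrite -size_t !size_cat.
- by rewrite repeat //; ring.
Qed.

Definition qwedge L t : R :=
  if perm_eq t L then (- mu) ^+ inv_count t else 0.

Lemma qwedge_qalternating L m : uniq L -> qalternating m (qwedge L).
Proof.
move=> uniqL; rewrite /qwedge; split=> [u a b v _ ab|u a v _].
  have -> : perm_eq (u ++ [:: b, a & v]) L = perm_eq (u ++ [:: a, b & v]) L.
    by apply: permPl; rewrite perm_cat2l; exact/permPl/(perm_catCA [:: b] [:: a]).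
  by case: ifP; rewrite ?mulr0 // inv_count_swap // exprS.
case: ifP => // /perm_uniq; rewrite uniqL cat_uniq /= inE eqxx.
by rewrite !andbF.
Qed.

End QuantumAlternating.

Section QuantumAlternatingDomain.
Variables (disp : Order.disp_t) (T : orderType disp) (R : idomainType) (mu : R).
Implicit Types (x : seq T -> R) (s t u v : seq T).

Lemma gq_at_eigen_qalternating m x : 1 + mu ^+ 2 != 0 ->
  (forall k t, size t = m -> (k.+1 < m)%N -> gq_at mu k x t = mu ^+ 2 * x t) ->
  qalternating mu m x.
Proof.
move=> onePq_neq0 eigen.
have eigen_at u a b v : size (u ++ [:: a, b & v]) = m ->
    gq_at mu 0 (fun s => x (u ++ s)) [:: a, b & v] = mu ^+ 2 * x (u ++ [:: a, b & v]).
  by move=> size_u; rewrite -gq_at_cat eigen // -size_u size_cat /=; lia.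
split=> [u a b v size_u ab|u a v size_u].
  have := eigen_at u b a v; rewrite /= (gt_eqF ab) ab !size_cat -size_u size_cat.
  move=> /(_ erefl); rewrite mulrBl mul1r addrCA => /(canRL (addKr _)).
  by rewrite addNr => /subr0_eq.
have := eigen_at u a a v size_u; rewrite /= eqxx ltxx mul0r addr0 mulN1r => /eqP.
rewrite eq_sym -addr_eq0 -[X in _ + X]mul1r -mulrDl addrC mulf_eq0.
by rewrite (negPf onePq_neq0) => /eqP.
Qed.

Hypothesis mu_neq0 : mu != 0.

Lemma qalternating_perm m x s t : qalternating mu m x -> size s = m -> perm_eq s t ->
  x s * (- mu) ^+ inv_count t = x t * (- mu) ^+ inv_count s.
Proof.
case=> swap _ size_s st.
pose P r := size r = m /\ x s * (- mu) ^+ inv_count r = x r * (- mu) ^+ inv_count s.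
suff /(_ s t st) [] : forall s t, perm_eq s t -> P s -> P t by [].
apply: adjacent_swap_perm_ind => u a b v [size_ab xE].
have size_ba : size (u ++ [:: b, a & v]) = m by rewrite -size_ab !size_cat.
split=> //; case: (ltgtP a b) => [ab|ba|ab]; last by rewrite ab in xE *.
  by rewrite inv_count_swap // exprS mulrCA xE (swap _ _ _ _ size_ab ab) mulrA.
apply: (@mulfI _ (- mu)); first by rewrite oppr_eq0.
by rewrite mulrCA -exprS -inv_count_swap // xE (swap _ _ _ _ size_ba ba) mulrA.
Qed.

Lemma qalternating_not_uniq m x t :
  qalternating mu m x -> size t = m -> ~~ uniq t -> x t = 0.
Proof.
move=> x_alt size_t /not_uniq_perm_eq[a [r tr]].
have := qalternating_perm x_alt size_t tr.
rewrite [in RHS](x_alt.2 [::]) -?(perm_size tr) // mul0r => /eqP.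
by rewrite mulf_eq0 expf_eq0 oppr_eq0 (negPf mu_neq0) andbF orbF => /eqP.
Qed.

End QuantumAlternatingDomain.

Lemma qalternatingP disp (T : finOrderType disp) (R : idomainType) (mu : R) m
    (x : seq T -> R) : 1 + mu ^+ 2 != 0 ->
  qalternating mu m x <-> hecke_eigen (mu ^+ 2) m (tens_gq mu m) (tuple_restr m x).
Proof.
move=> onePq_neq0; split=> [x_alt k km|x_eigen].
  apply/ffunP => t; rewrite tens_gq_tuple_restr !ffunE.
  by rewrite (gq_at_qalternating x_alt) ?size_tuple.
apply: gq_at_eigen_qalternating => // k t /eqP size_t km.
rewrite -[t]/(tval (Tuple size_t)) -tens_gq_tuple_restr.
by rewrite x_eigen // !ffunE.
Qed.

Section Contractions.
Variables (disp : Order.disp_t) (T : finOrderType disp) (C : numClosedFieldType).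
Variables (mu : C) (L : seq T) (m : nat).
Hypotheses (uniqL : uniq L) (sizeL : size L = m.+1).

Lemma qwedge_contract a b :
  \sum_(s : m.-tuple T) qwedge mu L (a :: s) * qwedge mu L (rcons s b) =
  if (a == b) && (a \in L) then (- mu) ^+ m * qfact (mu ^+ 2) m else 0.
Proof.
case: ifP => [/andP[/eqP <- aL]|ab].
  rewrite -(@sum_q_inv_count _ T _ _ _ (rem a L)) ?rem_uniq ?size_rem ?sizeL //.
  rewrite mulr_sumr [RHS]big_mkcond; apply: eq_bigr => s _.
  rewrite /qwedge perm_rcons (permPr (perm_to_rem aL)) perm_cons.
  case: ifP => [sL|]; last by rewrite mul0r.
  have a_notin : a \notin s by rewrite (perm_mem sL) mem_rem_uniqF.
  by rewrite -exprD inv_count_cons_rcons // size_tuple exprD exprM sqrrN mulrC.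
apply: big1 => s _; rewrite /qwedge perm_rcons.
case: ifP => [asL|]; case: ifP => [bsL|]; rewrite ?mul0r ?mulr0 //.
move: ab; rewrite -(perm_mem asL) mem_head andbT => /eqP[].
by apply: (@perm_cons_inj _ _ _ s); rewrite (permPl asL) perm_sym.
Qed.

(* Since [x] and the wedge are both proportional to (- mu)^inv, the letters of [s] and [u]
   may be exchanged: x s * qwedge (b :: u) = x u * qwedge (b :: s). *)
Lemma qwedge_contract_qalternating x b (u : m.-tuple T) :
  mu != 0 -> qalternating mu m x ->
  \sum_(s : m.-tuple T) qwedge mu L (rcons s b) * x s * qwedge mu L (b :: u) =
  if perm_eq (b :: u) L then (- mu) ^+ m * qfact (mu ^+ 2) m * x u else 0.
Proof.
move=> mu_neq0 x_alt; case: ifP => [buL|buL]; last first.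
  by apply: big1 => s _; rewrite {2}/qwedge buL mulr0.
have bL : b \in L by rewrite -(perm_mem buL) mem_head.
have := qwedge_contract b b; rewrite eqxx bL /= => <-; rewrite mulr_suml.
apply: eq_bigr => s _; rewrite /qwedge perm_rcons buL -(permPr buL) perm_cons.
case: ifP => [su|]; last by rewrite !mul0r.
rewrite /= (seq.permP su) !exprD mulrACA.
by rewrite (qalternating_perm mu_neq0 x_alt (size_tuple s) su); ring.
Qed.

End Contractions.

Lemma Svec_qwedge (C : numClosedFieldType) d n (mu : C) (i : 'I_n -> 'I_d) t :
  {homo i : a b / (a < b)%O} -> Svec mu i t = qwedge mu (codom i) t.
Proof.
move=> i_incr; have i_inj : injective i := inc_inj (le_mono i_incr).
have inv_perm (p : 'S_n) : inv_count [seq i (p k) | k <- enum 'I_n] = inversions p.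
  rewrite (inv_count_map_enum (i \o p)); apply: eq_card => -[a b].
  by rewrite !inE /= (leW_mono (le_mono i_incr)).
have permE (p : 'S_n) :
    [seq i (p k) | k <- enum 'I_n] = [tuple tnth [tuple i k | k < n] (p k) | k < n].
  by apply: eq_map => k; rewrite tnth_mktuple.
rewrite /Svec /qwedge; case: (tuple_permP (t := [tuple i k | k < n])) => [[p tE]|nt].
  rewrite -permE in tE; rewrite (bigD1 p) //= tE eqxx mulr1 inv_perm.
  rewrite big1 ?addr0 // => p' p'p; case: eqP => [pE|]; last by rewrite mulr0.
  case/eqP: p'p; apply/permP => k; apply: i_inj.
  by move/eq_in_map: pE => /(_ k) ->; rewrite // mem_enum.
apply: big1 => p _; case: eqP => [tE|]; last by rewrite mulr0.
by case: nt; exists p; rewrite -permE.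
Qed.

Section ElementaryTensors.
Variables (C : numClosedFieldType) (d n : nat) (i : 'I_n -> 'I_d).
Hypothesis i_inj : injective i.
Implicit Types (V : tens C d -> Prop) (z : tens C d).

Definition basis_vec (a : 'I_d) : tens C d := fun u => (u == [:: a])%:R.

Lemma basis_vec_in_Hi j : in_Hi_pow i 1 (basis_vec (i j)).
Proof.
move=> t; rewrite /basis_vec; case: (tval t =P _) => [->|_]; last by rewrite eqxx.
by rewrite /= codom_f.
Qed.

Lemma sum_basis_vec (F : 'I_d -> C) b : (b \notin codom i -> F b = 0) ->
  \sum_j F (i j) * basis_vec (i j) [:: b] = F b.
Proof.
have basisE j : basis_vec (i j) [:: b] = (b == i j)%:R.
  by rewrite /basis_vec eqseq_cons andbT.
under eq_bigr => j _ do rewrite basisE.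
have [/codomP[j ->] _|bi ->//] := boolP (b \in codom i).
  rewrite (bigD1 j) //= eqxx mulr1 big1 ?addr0 // => l lj.
  by rewrite (inj_eq i_inj) eq_sym (negPf lj) mulr0.
apply: big1 => j _; case: eqP => [bE|]; last by rewrite mulr0.
by rewrite bE codom_f in bi.
Qed.

Lemma in_tens_rcons m V z : (forall j, V (fun u => z (rcons u (i j)))) ->
  (forall u b, b \notin codom i -> z (rcons u b) = 0) ->
  in_tens m 1 V (in_Hi_pow i 1) z.
Proof.
move=> Vz z_supp.
exists n, (fun j u => z (rcons u (i j))), (fun j => basis_vec (i j)).
split=> //; split; first exact: basis_vec_in_Hi.
move=> t; have : size t == m.+1 by rewrite size_tuple addn1.
case/lastP: (tval t) => [//|s b]; rewrite size_rcons eqSS => /eqP size_s.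
rewrite /tprod -cats1 take_size_cat // drop_size_cat // cats1.
by rewrite (sum_basis_vec (F := fun b => z (rcons s b))) //; exact: z_supp.
Qed.

Lemma in_tens_cons m V z : (forall j, V (fun u => z (i j :: u))) ->
  (forall u b, b \notin codom i -> z (b :: u) = 0) ->
  in_tens 1 m (in_Hi_pow i 1) V z.
Proof.
move=> Vz z_supp.
exists n, (fun j => basis_vec (i j)), (fun j u => z (i j :: u)).
split; first exact: basis_vec_in_Hi.
split=> // t; case/tupleP: t => b t; rewrite /tprod /= take0 drop0.
under eq_bigr => j _ do rewrite mulrC.
by rewrite (sum_basis_vec (F := fun b => z (b :: t))) //; exact: z_supp.
Qed.

End ElementaryTensors.

Lemma in_HbarP (C : numClosedFieldType) (mu : C) d k (i : 'I_k.+2 -> 'I_d)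
    (x : tens C d) : 0 < mu ->
  in_Hbar (mu ^+ 2) mu i x <-> qalternating mu k.+1 x /\ in_Hi_pow i k.+1 x.
Proof.
move=> mu_gt0; have q_gt0 : 0 < mu ^+ 2 by rewrite exprn_gt0.
have onePq_neq0 : 1 + mu ^+ 2 != 0 by rewrite gt_eqF // addr_gt0.
split=> [[y [y_supp xE]]|[/(qalternatingP _ _ onePq_neq0) x_eigen x_supp]]; last first.
  exists x; split=> // t; rewrite epsE_qantisym (qantisym_of_eigen x_eigen) scalerA.
  by rewrite mulVf ?scale1r ?ffunE // gt_eqF // qfact_gt0.
split=> [|t].
  apply/(qalternatingP _ _ onePq_neq0).
  have -> : tuple_restr k.+1 x = (qfact (mu ^+ 2) k.+1)^-1 *:
      qantisym (tens_gq mu k.+1) k (tuple_restr k.+1 y).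
    by apply/ffunP => t; rewrite ffunE xE epsE_qantisym.
  move=> j jk; rewrite linearZ /= (qantisym_eigen _ (tens_gq_relations _ mu k.+1)) //.
  by rewrite !scalerA mulrC.
apply: contraNT => t_out; rewrite xE epsE_gq_word big1 ?mulr0 // => w _.
rewrite -(gq_word0 mu w t); apply: gq_word_local => s st.
apply: contraNeq t_out; rewrite -(perm_all _ st).
have /eqP size_s : size s = k.+1 by rewrite (perm_size st) size_tuple.
exact: (y_supp (Tuple size_s)).
Qed.

Section Conjugates.
Variables (C : numClosedFieldType) (mu : C) (d k : nat) (i : 'I_k.+2 -> 'I_d).
Hypotheses (mu_gt0 : 0 < mu) (i_incr : {homo i : a b / (a < b)%O}).

Let q : C := mu ^+ 2.
Let R_scale : C := (sqrtC mu ^+ k.+1 * sqrtC (qfact q k.+1))^-1.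
Let R : tens C d := fun t => R_scale * Svec mu i t.
Let Rbar : tens C d := fun t => (-1) ^+ k.+1 * R t.

Let i_inj : injective i := inc_inj (le_mono i_incr).

Lemma uniq_codom : uniq (codom i).
Proof. by rewrite map_inj_uniq ?enum_uniq. Qed.

Lemma size_codom_ord : size (codom i) = k.+2.
Proof. by rewrite size_codom card_ord. Qed.

Lemma R_scale_gt0 : 0 < R_scale.
Proof.
by rewrite invr_gt0 mulr_gt0 ?exprn_gt0 ?sqrtC_gt0 ?qfact_gt0 // exprn_gt0.
Qed.

Lemma R_scale_contract :
  (-1) ^+ k.+1 * R_scale ^+ 2 * ((- mu) ^+ k.+1 * qfact q k.+1) = 1.
Proof.
have scaleE : R_scale ^- 2 = mu ^+ k.+1 * qfact q k.+1.
  by rewrite -exprVn /R_scale invrK exprMn exprAC !sqrtCK.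
rewrite mulrACA -exprMn mulN1r opprK mulrCA -scaleE divff //.
by rewrite expf_neq0 // gt_eqF // R_scale_gt0.
Qed.

Lemma R_qwedge t : R t = R_scale * qwedge mu (codom i) t.
Proof. by rewrite /R Svec_qwedge. Qed.

Lemma R_conj t : (R t)^* = R t.
Proof.
rewrite R_qwedge /qwedge; apply/CrealP/rpredM; first exact/gtr0_real/R_scale_gt0.
by case: ifP => _; rewrite ?rpred0 // rpredX // rpredN gtr0_real.
Qed.

Lemma Rbar_conj t : (Rbar t)^* = Rbar t.
Proof. by rewrite /Rbar rmorphM /= R_conj rmorphXn rmorphN1. Qed.

Lemma R_qalternating m : qalternating mu m R.
Proof.
have [swap repeat] := qalternatingZ R_scale (qwedge_qalternating mu m uniq_codom).
by split=> *; rewrite !R_qwedge; [apply: swap|apply: repeat].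
Qed.

Lemma R_supp t b : b \in t -> b \notin codom i -> R t = 0.
Proof.
move=> bt; rewrite R_qwedge /qwedge; case: ifP => [/perm_mem <-|]; rewrite ?mulr0 //.
by rewrite bt.
Qed.

Lemma R_in_Hbar_Hi : in_tens k.+1 1 (in_Hbar q mu i) (in_Hi_pow i 1) R.
Proof.
apply: in_tens_rcons => // [j|u b bi]; last first.
  by apply: (R_supp _ bi); rewrite mem_rcons mem_head.
apply/(in_HbarP _ _ mu_gt0); split.
  exact: (qalternating_rcons _ (R_qalternating k.+2)).
move=> t; apply: contraNT => /allPn[b bt bi]; apply/eqP/(R_supp _ bi).
by rewrite mem_rcons inE bt orbT.
Qed.

Lemma Rbar_in_Hi_Hbar : in_tens 1 k.+1 (in_Hi_pow i 1) (in_Hbar q mu i) Rbar.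
Proof.
apply: in_tens_cons => // [j|u b bi]; last first.
  by rewrite /Rbar (R_supp _ bi) ?mulr0 ?mem_head.
apply/(in_HbarP _ _ mu_gt0); split.
  exact/qalternatingZ/(qalternating_cons _ (R_qalternating k.+2)).
move=> t; apply: contraNT => /allPn[b bt bi]; apply/eqP.
by rewrite /Rbar (R_supp _ bi) ?mulr0 // inE bt orbT.
Qed.

Lemma conjugate_equation_Hi (v : tens C d) : in_Hi_pow i 1 v ->
  teq 1 (contr k.+2 Rbar (tprod 1 v R)) v.
Proof.
move=> v_supp t; case/tupleP: t => b t; rewrite tuple0 /contr /= sum_tuple_cons.
pose sign_scale := (-1) ^+ k.+1 * R_scale ^+ 2.
have termE a (s : k.+1.-tuple 'I_d) :
    (Rbar (a :: s))^* * tprod 1 v R ((a :: s) ++ [:: b]) =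
    v [:: a] * sign_scale
    * (qwedge mu (codom i) (a :: s) * qwedge mu (codom i) (rcons s b)).
  by rewrite Rbar_conj /tprod /= take0 drop0 cats1 /Rbar !R_qwedge /sign_scale; ring.
under eq_bigr => a _.
  under eq_bigr => s _ do rewrite termE.
  rewrite -mulr_sumr (qwedge_contract _ uniq_codom size_codom_ord); over.
rewrite (bigD1 b) //= eqxx /= big1 ?addr0 => [|a /negPf ->]; last exact: mulr0.
case: ifP => [_|bi]; first by rewrite -mulrA R_scale_contract mulr1.
have -> : v [:: b] = 0; last by rewrite mulr0.
by apply: contraFeq bi => /(v_supp [tuple b]); rewrite /= andbT.
Qed.

Lemma conjugate_equation_Hbar (x : tens C d) : in_Hbar q mu i x ->
  teq k.+1 (contr k.+2 R (tprod k.+1 x Rbar)) x.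
Proof.
case/(in_HbarP _ _ mu_gt0)=> x_alt x_supp u; rewrite /contr sum_tuple_rcons.
have mu_neq0 : mu != 0 by rewrite gt_eqF.
pose sign_scale := (-1) ^+ k.+1 * R_scale ^+ 2.
have termE b (s : k.+1.-tuple 'I_d) :
    (R (rcons s b))^* * tprod k.+1 x Rbar (rcons s b ++ u) =
    sign_scale
    * (qwedge mu (codom i) (rcons s b) * x s * qwedge mu (codom i) (b :: u)).
  rewrite R_conj /tprod cat_rcons take_size_cat ?drop_size_cat ?size_tuple //.
  by rewrite /Rbar !R_qwedge /sign_scale; ring.
under eq_bigr => b _.
  under eq_bigr => s _ do rewrite termE.
  rewrite -mulr_sumr (qwedge_contract_qalternating uniq_codom size_codom_ord) //; over.
have [xu0|xu] := eqVneq (x u) 0.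
  by rewrite xu0 big1 // => b _; rewrite mulr0 if_same mulr0.
have [b buL] : exists b, perm_eq (b :: u) (codom i).
  apply: uniq_complete_perm; rewrite ?uniq_codom ?size_codom_ord ?size_tuple //.
    apply: contraNT xu => u_repeats; apply/eqP.
    by apply: (qalternating_not_uniq mu_neq0 x_alt); rewrite ?size_tuple.
  exact/allP/x_supp.
rewrite (bigD1 b) //= buL big1 ?addr0 => [|a ab].
  by rewrite mulrA R_scale_contract mul1r.
case: ifP => [auL|]; rewrite ?mulr0 //; case/eqP: ab.
by apply: (@perm_cons_inj _ _ _ u); rewrite (permPl auL) perm_sym.
Qed.

End Conjugates.

Theorem theorem5p5 (C : numClosedFieldType) (q : C) (d n : nat)
    (i : 'I_n -> 'I_d) :
  0 < q -> (2 <= n)%N -> (n <= d)%N ->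
  (forall a b : 'I_n, (a < b)%N -> (i a < i b)%N) ->
  let mu := sqrtC q in
  let R : tens C d := fun t =>
    (sqrtC mu ^+ n.-1 * sqrtC (qfact q n.-1))^-1 * Svec mu i t in
  let Rbar : tens C d := fun t => (-1) ^+ n.-1 * R t in
  let Hi := in_Hi_pow i 1 in
  let Hbar := in_Hbar q mu i in
  [/\ in_tens n.-1 1 Hbar Hi R,
      in_tens 1 n.-1 Hi Hbar Rbar,
      (forall v : tens C d, Hi v -> teq 1 (contr n Rbar (tprod 1 v R)) v) &
      (forall x : tens C d, Hbar x -> teq n.-1 (contr n R (tprod n.-1 x Rbar)) x)].
Proof.
case: n i => [|[|k]] // i q_gt0 _ _ i_incr mu R Rbar Hi Hbar.
have mu_gt0 : 0 < mu by rewrite sqrtC_gt0.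
rewrite /Hbar /Rbar /R -[q]sqrtCK -/mu; split.
- exact: R_in_Hbar_Hi.
- exact: Rbar_in_Hi_Hbar.
- exact: conjugate_equation_Hi.
- exact: conjugate_equation_Hbar.
Qed.
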